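(* Let $Q$ be an $n$-dimensional manifold with a rank-$m$ nonholonomic constraint distribution $\mathcal D$, constraint submanifold $\mathcal C\subset TQ$, and an adapted frame $\{X_i\}=\{X_\alpha,X_a\}$ with quasi-velocities $v^i$. Let $L$ be a regular Lagrangian on $TQ$ which is regular with respect to both $\mathcal D$ and $\mathcal D^\perp$, and let $\Gamma$ be its nonholonomic dynamical vector field, with multipliers $\lambda_a$. The following three statements are equivalent. (i) The vakonomic (variational nonholonomic) problem and the nonholonomic dynamics are weakly consistent. (ii) There is a section $\phi$ of the projection $\mathcal C\times\mathbb R^{n-m}\to\mathcal C$ such that $\phi_aR^a_{\alpha\beta}v^\beta=0$ on $\mathcal C$ for $\alpha=1,\dots,m$. (iii) There is a section $\phi$ of the projection $\mathcal C\times\mathbb R^{n-m}\to\mathcal C$ such that the vector field $\bar\Gamma$ on $\operatorname{im}(\phi)$ given by $$\bar\Gamma=\Gamma+(\lambda_a-\phi_bR^b_{a\alpha}v^\alpha)\frac{\partial}{\partial\mu_a}$$ satisfies the vakonomic equations on $\operatorname{im}(\phi)$.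
   Context: All considerations are local: $Q$ may be taken to be the domain of the frame. Summation convention. $\tau:TQ\to Q$; local coordinates $q^i$ on $Q$, fibre coordinates $u^i$ on $TQ$. For a vector field $Z=Z^i\,\partial/\partial q^i$ on $Q$: complete lift $Z^{\mathrm C}=Z^i\frac{\partial}{\partial q^i}+u^j\frac{\partial Z^i}{\partial q^j}\frac{\partial}{\partial u^i}$, vertical lift $Z^{\mathrm V}=Z^i\frac{\partial}{\partial u^i}$. $\mathcal D$ is a non-integrable smooth distribution on $Q$ of constant rank $m$, and $\mathcal C=\{(q,u)\in TQ:u\in\mathcal D_q\}$. An adapted frame is a frame $\{X_i\}$, $i=1,\dots,n$, on $Q$ whose first $m$ members $\{X_\alpha\}$, $\alpha=1,\dots,m$, span $\mathcal D$; the others are $\{X_a\}$, $a=m+1,\dots,n$. Its dual coframe is $\{\theta^i\}$; the quasi-velocities are the functions $v^i(q,u)=\theta^i_q(u)$ on $TQ$, so $\mathcal C$ is given by $v^a=0$. The functions $R^k_{ij}$ are defined by $[X_i,X_j]=R^k_{ij}X_k$. Let $g_{ij}=X_i^{\mathrm V}(X_j^{\mathrm V}(L))$. $L$ is regular if $(g_{ij})$ is nonsingular; regular with respect to $\mathcal D$ if $(g_{\alpha\beta})$ is nonsingular on $\mathcal C$; and then, with $(g^{\alpha\beta})$ the inverse of $(g_{\alpha\beta})$, regular with respect to $\mathcal D^\perp$ if $(g_{ab}-g^{\alpha\beta}g_{a\alpha}g_{b\beta})$ is nonsingular on $\mathcal C$. Nonholonomic dynamics: $\Gamma$ is the unique vector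 field on $\mathcal C$ which is of second-order type ($\tau_{*(q,u)}\Gamma=u$ on $\mathcal C$), tangent to $\mathcal C$, and satisfies $\Gamma(X_\alpha^{\mathrm V}(L))-X_\alpha^{\mathrm C}(L)=0$ on $\mathcal C$ for $\alpha=1,\dots,m$. Its multipliers are the functions $\lambda_a=\Gamma(X_a^{\mathrm V}(L))-X_a^{\mathrm C}(L)$ on $\mathcal C$. Vakonomic problem: on $TQ\times\mathbb R^{n-m}$ (coordinates $\mu_a$ on $\mathbb R^{n-m}$) let $\hat\omega=d\big(X_i^{\mathrm V}(L)\theta^i-\mu_a\theta^a\big)$ and $E=v^iX_i^{\mathrm V}(L)-L$ (pullbacks not indicated). The vakonomic equations for a vector field $\hat\Gamma$ are $\hat\Gamma\lrcorner\hat\omega=-dE$; solutions exist only at points of $\mathcal C\times\mathbb R^{n-m}$. A section $\phi$ is given by functions $\phi_a$ on $\mathcal C$; $\operatorname{im}(\phi)=\{(w,\mu):w\in\mathcal C,\ \mu_a=\phi_a(w)\}$. A vector field on $\operatorname{im}(\phi)$ assigns to each of its points a tangent vector to $TQ\times\mathbb R^{n-m}$ there, not necessarily tangent to $\operatorname{im}(\phi)$; functions on $\mathcal C$ are transported to $\operatorname{im}(\phi)$ via $\phi$. Under the regularity assumptions, for each section $\phi$ there is a unique vector field $\hat\Gamma$ on $\operatorname{im}(\phi)$ which satisfies the vakonomic equations there and whose $TQ$-component $\Gamma_{\mathcal C}$ (regarded as a field of tangent vectors to $TQ$ at points of $\mathcal C$) is tangent to $\mathcal C$. The vakonomic and nonholonomic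 problems are weakly consistent if there is a section $\phi$ such that the corresponding $\Gamma_{\mathcal C}$ equals $\Gamma$. *)

(* Defs.v *)
From mathcomp Require Import all_boot all_order all_algebra.
From mathcomp Require Import all_classical all_reals all_analysis.

Set Implicit Arguments.
Unset Strict Implicit.
Unset Printing Implicit Defensive.

Import Order.TTheory GRing.Theory Num.Theory.
Import numFieldNormedType.Exports.

Local Open Scope classical_set_scope.
Local Open Scope ring_scope.

(* The configuration space Q is an open subset U of
   'rV[R]_(m + p), with m the rank of the distribution and p = n - m.  A Greek
   index al : 'I_m stands for the frame index lshift p al, a Latin index
   a : 'I_p for rshift m a.  A point (q, u) of TQ is a pair, and a point of
   TQ x R^p is a pair ((q, u), mu).  Every object living on a subset is a total
   function of which only the values on that subset are used. *)

Section Smoothness.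
Context {R : realType} {V W : normedModType R}.

(* In finite dimension this is the usual class C^k on the open set A. *)
Fixpoint Ck (k : nat) (A : set V) (f : V -> W) : Prop :=
  match k with
  | 0 => forall x, A x -> {for x, continuous f}
  | k'.+1 => (forall x, A x -> differentiable f x) /\
             forall v, Ck k' A (fun x => 'D_v f x)
  end.

Definition smooth (A : set V) (f : V -> W) := forall k, Ck k A f.

(* Smoothness on an arbitrary subset: local extendability to a smooth function
   on an open set. *)
Definition smooth_on (S : set V) (f : V -> W) :=
  forall x, S x -> exists O : set V, exists g : V -> W,
    [/\ open O, O x, smooth O g & forall y, S y -> O y -> f y = g y].

End Smoothness.

Section Calculus.
Context {R : realType} {V : normedModType R}.

Definition tangent_vector (S : set V) (x xi : V) :=
  exists e : R, exists c : R -> V,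
    [/\ 0 < e, smooth [set` `]- e, e[] c, forall t, t \in `]- e, e[ -> S (c t),
        c 0 = x & derive1 c 0 = xi].

Definition apply_vf (Z : V -> V) (f : V -> R) : V -> R := fun x => 'D_(Z x) f x.

Definition bracket (Y Z : V -> V) : V -> V :=
  fun x => 'D_(Y x) Z x - 'D_(Z x) Y x.

(* A 1-form omega is encoded by omega x w, the value at x on the vector w.  The
   arguments w1, w2 are extended to constant, hence commuting, vector fields. *)
Definition ext_d (omega : V -> V -> R) (x w1 w2 : V) : R :=
  'D_w1 (fun y => omega y w2) x - 'D_w2 (fun y => omega y w1) x.

End Calculus.

Section Lifts.
Context {R : realType} {n : nat}.
Local Notation E := 'rV[R]_n.

Definition tangent_bundle (U : set E) : set (E * E) := U `*` setT.

Definition complete_lift (Z : E -> E) : E * E -> E * E :=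
  fun w => (Z w.1, 'D_(w.2) Z w.1).

Definition vertical_lift (Z : E -> E) : E * E -> E * E :=
  fun w => (0, Z w.1).

(* th q is the column of components of a covector at q. *)
Definition covec_app (th : E -> 'cV[R]_n) (q u : E) : R := (u *m th q) 0 0.

End Lifts.

Section Constraints.
Context {R : realType} {m p : nat}.
Local Notation E := 'rV[R]_(m + p).
Implicit Types (U : set E) (D : E -> {vspace E}) (X : 'I_(m + p) -> E -> E)
  (theta : 'I_(m + p) -> E -> 'cV[R]_(m + p)).

Definition constraint_set U D : set (E * E) :=
  [set w | U w.1 /\ w.2 \in D w.1].

(* Through every point of U passes an integral manifold, given by a
   parametrization s.  Here D has rank m, so s is an immersion. *)
Definition integrable_distribution U D :=
  forall q, U q -> exists O : set 'rV[R]_m, exists s : 'rV[R]_m -> E,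
    [/\ open O, O 0, smooth O s, s 0 = q &
        forall t, O t -> U (s t) /\
          forall v, v \in D (s t) <-> exists t', 'D_t' s t = v].

(* The existence of such an X makes D smooth of constant rank m on U. *)
Definition adapted_frame U D X :=
  (forall i, smooth U (X i)) /\
  forall q, U q ->
    basis_of fullv [tuple X i q | i < m + p] /\
    D q = <<[tuple X (lshift p al) q | al < m]>>%VS.

Definition dual_coframe U X theta :=
  (forall i, smooth U (theta i)) /\
  forall q, U q -> forall i j, covec_app (theta i) q (X j q) = (i == j)%:R.

Definition quasi_velocity theta (i : 'I_(m + p)) (w : E * E) : R :=
  covec_app (theta i) w.1 w.2.

(* The coefficient of X_k in [X_i, X_j]. *)
Definition struct_fun X theta (k i j : 'I_(m + p)) (q : E) : R :=
  covec_app (theta k) q (bracket (X i) (X j) q).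

End Constraints.

Section Lagrangian.
Context {R : realType} {m p : nat}.
Local Notation E := 'rV[R]_(m + p).
Implicit Types (U : set E) (D : E -> {vspace E}) (X : 'I_(m + p) -> E -> E)
  (L : E * E -> R) (w : E * E).

Definition vert_deriv X L (i : 'I_(m + p)) : E * E -> R :=
  apply_vf (vertical_lift (X i)) L.

Definition comp_deriv X L (i : 'I_(m + p)) : E * E -> R :=
  apply_vf (complete_lift (X i)) L.

Definition hess X L w : 'M[R]_(m + p) :=
  \matrix_(i, j) apply_vf (vertical_lift (X i)) (vert_deriv X L j) w.

Definition hessD X L w : 'M[R]_m :=
  \matrix_(al, be) hess X L w (lshift p al) (lshift p be).

Definition hessDperp X L w : 'M[R]_p :=
  \matrix_(a, b) (hess X L w (rshift m a) (rshift m b) -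
    \sum_(al < m) \sum_(be < m) invmx (hessD X L w) al be *
      hess X L w (rshift m a) (lshift p al) *
      hess X L w (rshift m b) (lshift p be)).

Definition regular U X L :=
  forall w, tangent_bundle U w -> hess X L w \in unitmx.

Definition regular_wrt_D U D X L :=
  forall w, constraint_set U D w -> hessD X L w \in unitmx.

Definition regular_wrt_Dperp U D X L :=
  forall w, constraint_set U D w -> hessDperp X L w \in unitmx.

End Lagrangian.

Section Dynamics.
Context {R : realType} {m p : nat}.
Local Notation E := 'rV[R]_(m + p).
Implicit Types (U : set E) (D : E -> {vspace E}) (X : 'I_(m + p) -> E -> E)
  (theta : 'I_(m + p) -> E -> 'cV[R]_(m + p)) (L : E * E -> R)
  (Gam : E * E -> E * E) (phi : E * E -> 'rV[R]_p)
  (w : E * E) (z : (E * E) * 'rV[R]_p).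

Definition EL_expr X L Gam (i : 'I_(m + p)) w : R :=
  apply_vf Gam (vert_deriv X L i) w - comp_deriv X L i w.

Definition nonholonomic_dynamics U D X L Gam :=
  smooth_on (constraint_set U D) Gam /\
  forall w, constraint_set U D w ->
    [/\ (Gam w).1 = w.2,
        tangent_vector (constraint_set U D) w (Gam w) &
        forall al : 'I_m, EL_expr X L Gam (lshift p al) w = 0].

Definition multiplier X L Gam (a : 'I_p) w : R := EL_expr X L Gam (rshift m a) w.

Definition vak_form X theta L z (xi : (E * E) * 'rV[R]_p) : R :=
  \sum_(i < m + p) vert_deriv X L i z.1 * covec_app (theta i) z.1.1 xi.1.1 -
  \sum_(a < p) z.2 0 a * covec_app (theta (rshift m a)) z.1.1 xi.1.1.

Definition energy X theta L z : R :=
  \sum_(i < m + p) quasi_velocity theta i z.1 * vert_deriv X L i z.1 - L z.1.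

Definition vakonomic_eq X theta L z (zeta : (E * E) * 'rV[R]_p) :=
  forall xi, ext_d (vak_form X theta L) z zeta xi =
             - 'D_xi (energy X theta L) z.

Definition is_section U D phi := smooth_on (constraint_set U D) phi.

Definition im_section U D phi : set ((E * E) * 'rV[R]_p) :=
  [set (w, phi w) | w in constraint_set U D].

Definition vakonomic_on U D X theta L phi
    (Gh : (E * E) * 'rV[R]_p -> (E * E) * 'rV[R]_p) :=
  forall z, im_section U D phi z -> vakonomic_eq X theta L z (Gh z).

Definition vakonomic_dynamics U D X theta L phi
    (Gh : (E * E) * 'rV[R]_p -> (E * E) * 'rV[R]_p) :=
  [/\ smooth_on (im_section U D phi) Gh,
      vakonomic_on U D X theta L phi Gh &
      forall w, constraint_set U D w ->
        tangent_vector (constraint_set U D) w (Gh (w, phi w)).1].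

(* Under the regularity assumptions Gh is determined by phi on im_section. *)
Definition weakly_consistent U D X theta L Gam :=
  exists phi, exists Gh,
    [/\ is_section U D phi, vakonomic_dynamics U D X theta L phi Gh &
        forall w, constraint_set U D w -> (Gh (w, phi w)).1 = Gam w].

(* Gam + (lambda_a - phi_b R^b_{a al} v^al) d/dmu_a, along im_section. *)
Definition Gam_bar X theta L Gam phi z : (E * E) * 'rV[R]_p :=
  (Gam z.1,
   \row_(a < p) (multiplier X L Gam a z.1 -
     \sum_(b < p) \sum_(al < m) phi z.1 0 b *
       struct_fun X theta (rshift m b) (rshift m a) (lshift p al) z.1.1 *
       quasi_velocity theta (lshift p al) z.1)).

End Dynamics.

(* Main.v *)
(* Let zeta = (Gamma, nu) at a point (q, u, mu) with u in D_q.  Since the base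
   component of Gamma is u and v^a = 0, the 1-form zeta _| omega + dE vanishes on
   vertical vectors and on the d/dmu_a, so it is determined by its values on the
   complete lifts of the X_j, which are
     Gamma(X_j^V(L)) - X_j^C(L) - nu_j - mu_b R^b_{j be} v^be,   nu_al = 0.
   For j = al the first two terms cancel and mu_b R^b_{al be} v^be = 0 remains;
   for j = a the equation says that nu_a is the coefficient of Gam_bar.  Hence
   the vakonomic equations along phi with TQ-component Gamma are equivalent to
   reaction-freeness of phi together with nu being that of Gam_bar. *)
Require Import Defs.
From HB Require Import structures.
From mathcomp Require Import all_boot all_order all_algebra.
From mathcomp Require Import all_classical all_reals all_analysis.
From mathcomp Require Import ring.
Import Order.TTheory GRing.Theory Num.Theory.
Import numFieldNormedType.Exports.
Local Open Scope classical_set_scope.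
Local Open Scope ring_scope.

(** * Directional derivatives: linear maps, product rule, linearity in the direction, locality *)

Section DirectionalDerivatives.
Context {R : realType}.
Implicit Types V W : normedModType R.

Lemma is_diff_linear {V W} {l : V -> W} (x : V) :
  linear l -> continuous l -> is_diff x l l.
Proof.
(* Here [linear l] is a mere proposition; packing it with [l] gives a bundled linear map, to which
   the facts on differentials of linear maps apply. *)
move=> ll cl; pose lM := GRing.isLinear.Build _ _ _ _ _ ll.
pose lL : {linear _ -> _} := HB.pack l lM.
rewrite -[l]/(lL : _ -> _).
by apply: DiffDef; [exact/linear_differentiable|exact: diff_lin].
Qed.

Lemma derive_linear_comp {V W W' : normedModType R} {f : V -> W} {l : W -> W'}
    {x v : V} :
  linear l -> continuous l -> differentiable f x ->
  'D_v (fun y => l (f y)) x = l ('D_v f x).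
Proof.
move=> ll cl df; have dl := is_diff_linear (f x) ll cl.
rewrite deriveE; last exact: differentiable_comp.
by rewrite deriveE// diff_comp//= [in LHS]diff_val.
Qed.

(** Since [h] carries the line through [x] along [v] to the line through [h x] along [h v], the two
    difference quotients are the same function. Hence neither differentiability of [f] nor
    continuity of [h] is assumed. *)
Lemma derive_comp_linear {V V' W : normedModType R} {f : V' -> W} {h : V -> V'}
    {x v : V} :
  linear h -> 'D_v (fun y => f (h y)) x = 'D_(h v) f (h x).
Proof.
by move=> lh; rewrite /derive /shift /=; under eq_fun do rewrite lh.
Qed.

Lemma derive_mul {V} {f g : V -> R} {x v : V} :
  differentiable f x -> differentiable g x ->
  'D_v (fun y => f y * g y) x = f x * 'D_v g x + g x * 'D_v f x.
Proof. by move=> df dg; rewrite deriveM//; exact: diff_derivable. Qed.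

Lemma derive_add {V W} {f g : V -> W} {x v : V} :
  differentiable f x -> differentiable g x ->
  'D_v (fun y => f y + g y) x = 'D_v f x + 'D_v g x.
Proof. by move=> df dg; rewrite deriveD//; exact: diff_derivable. Qed.

Lemma derive_opp {V W} {f : V -> W} {x v : V} :
  differentiable f x -> 'D_v (fun y => - f y) x = - 'D_v f x.
Proof. by move=> df; rewrite deriveN//; exact: diff_derivable. Qed.

Lemma differentiable_bigsum {V W} {I : Type} {s : seq I} {f : I -> V -> W} {x : V} :
  (forall i, differentiable (f i) x) ->
  differentiable (fun y => \sum_(i <- s) f i y) x.
Proof.
move=> df; elim: s => [|i s IH].
  under eq_fun do rewrite big_nil; exact: differentiable_cst.
under eq_fun do rewrite big_cons; exact: differentiableD.
Qed.

Lemma derive_bigsum {V W} {I : Type} {s : seq I} {f : I -> V -> W} {x v : V} :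
  (forall i, differentiable (f i) x) ->
  'D_v (fun y => \sum_(i <- s) f i y) x = \sum_(i <- s) 'D_v (f i) x.
Proof.
move=> df; elim: s => [|i s IH].
  by rewrite big_nil; under eq_fun do rewrite big_nil; exact: derive_cst.
rewrite big_cons -IH; under eq_fun do rewrite big_cons.
by rewrite derive_add//; exact: differentiable_bigsum.
Qed.

Lemma derive_dirD {V W} {f : V -> W} {x v w : V} :
  differentiable f x -> 'D_(v + w) f x = 'D_v f x + 'D_w f x.
Proof. by move=> df; rewrite !deriveE// linearD. Qed.

Lemma derive_dirZ {V W} {f : V -> W} {x v : V} (a : R) :
  differentiable f x -> 'D_(a *: v) f x = a *: 'D_v f x.
Proof. by move=> df; rewrite !deriveE// linearZ. Qed.

Lemma derive_dir_sum {V W} {I : Type} {s : seq I} {f : V -> W} {x : V} {v : I -> V} :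
  differentiable f x ->
  'D_(\sum_(i <- s) v i) f x = \sum_(i <- s) 'D_(v i) f x.
Proof.
by move=> df; rewrite deriveE// linear_sum; apply: eq_bigr => i _; rewrite deriveE.
Qed.

Lemma differentiable_near_eq {V W} {f g : V -> W} {x : V} :
  (\near x, f x = g x) -> differentiable f x -> differentiable g x.
Proof.
move=> fg df; have fgx : f x = g x := nbhs_singleton fg.
apply/diffP => /=.
(* The differential is defined by choice among the continuous linear maps giving a first-order
   expansion. It is enough to exhibit one such map for [g], and the differential of [f] serves. *)
apply: (@getPex _ (fun (df : {linear V -> W}) => continuous df /\
  forall y, g y = g (lim (nbhs x)) + df (y - lim (nbhs x))
                  +o_(y \near x) (y - lim (nbhs x)))).
exists ('d f x); split; first exact: diff_continuous.
have /diffP [_] := df; rewrite /= lim_id// => H.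
have {}H : f = (fun y => f x + 'd f x (y - x)) +o_ (nbhs x) (fun y => y - x).
  by apply/funext.
apply: eqaddoEx => z; move: z; apply/funeqP; apply/eqaddoP => eps eps0.
move/eqaddoP : H => /(_ _ eps0) H.
near=> y; rewrite !fctE/=.
rewrite -[g y](_ : f y = _); last by near: y.
by rewrite -fgx; near: y.
Unshelve. all: by end_near.
Qed.

End DirectionalDerivatives.

(** * Closure properties of smooth functions on open sets *)

Section SmoothFunctions.
Context {R : realType}.
Implicit Types V W : normedModType R.

Lemma CkS_Ck {V W} k (A : set V) (f : V -> W) : Ck k.+1 A f -> Ck k A f.
Proof.
elim: k f => [|k IH] f [df Df]; first by move=> x /df /differentiable_continuous.
by split=> // v; exact/IH/Df.
Qed.

Lemma Ck_subset {V W} k (A B : set V) (f : V -> W) : B `<=` A -> Ck k A f -> Ck k B f.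
Proof.
move=> BA; elim: k f => [|k IH] f /=; first by move=> cf x /BA; exact: cf.
by move=> [df Df]; split=> [x /BA /df//|v]; exact/IH/Df.
Qed.

(** On an open set, equality on [A] is equality near each point of [A], so it passes to all
    directional derivatives. This allows the inductions on [k] below to replace a derivative by a
    formula valid only on [A]. *)
Lemma Ck_eq {V W} k (A : set V) (f g : V -> W) : open A ->
  (forall x, A x -> f x = g x) -> Ck k A f -> Ck k A g.
Proof.
move=> oA; elim: k f g => [|k IH] f g fg /=.
  move=> cf x Ax; rewrite /prop_for /continuous_at -(fg x Ax).
  apply: cvg_trans (cf x Ax); apply: near_eq_cvg.
  by near=> y; rewrite fg//; near: y; exact: open_nbhs_nbhs.
have fgn x : A x -> \near x, f x = g x.
  by move=> Ax; near=> y; apply: fg; near: y; exact: open_nbhs_nbhs.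
move=> [df Df]; split=> [x Ax|v].
  exact: differentiable_near_eq (fgn x Ax) (df x Ax).
apply: IH (Df v) => x Ax; exact/near_eq_derive/fgn.
Unshelve. all: by end_near.
Qed.

Lemma Ck_cst {V W} k (A : set V) (c : W) : Ck k A (fun _ : V => c).
Proof.
elim: k c => [|k IH] c /=; first by move=> x _; exact: cst_continuous.
split=> [x _|v]; first exact: differentiable_cst.
rewrite (_ : (fun x => 'D_v _ x) = fun=> 0); first exact: IH.
by apply/funext => x; exact: derive_cst.
Qed.

Lemma Ck_linear_comp {V W W' : normedModType R} k (A : set V) (f : V -> W)
    (l : W -> W') : open A -> linear l -> continuous l ->
  Ck k A f -> Ck k A (fun x => l (f x)).
Proof.
move=> oA ll cl; elim: k f => [|k IH] f /=.
  by move=> cf x Ax; apply: continuous_comp; [exact: cf|exact: cl].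
move=> [df Df]; split=> [x Ax|v].
  have [dl _] := is_diff_linear (f x) ll cl.
  exact: (differentiable_comp (df x Ax) dl).
apply: Ck_eq (IH _ (Df v)) => // x Ax.
by rewrite (derive_linear_comp ll cl (df x Ax)).
Qed.

Lemma Ck_comp_linear {V V' W : normedModType R} k (A : set V') (f : V' -> W)
    (h : V -> V') : linear h -> continuous h ->
  Ck k A f -> Ck k (h @^-1` A) (fun x => f (h x)).
Proof.
move=> lh ch; elim: k f => [|k IH] f /=.
  by move=> cf x Ax; apply: continuous_comp; [exact: ch|exact: cf].
move=> [df Df]; split=> [x Ax|v].
  have [dh _] := is_diff_linear x lh ch.
  exact: (differentiable_comp dh (df _ Ax)).
rewrite (_ : (fun x => 'D_v _ x) = fun x => 'D_(h v) f (h x)); first exact: IH (Df (h v)).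
by apply/funext => x; exact: derive_comp_linear lh.
Qed.

Lemma Ck_add {V W} k (A : set V) (f g : V -> W) : open A ->
  Ck k A f -> Ck k A g -> Ck k A (fun x => f x + g x).
Proof.
move=> oA; elim: k f g => [|k IH] f g /=.
  by move=> cf cg x Ax; apply: cvgD; [exact: cf|exact: cg].
move=> [df Df] [dg Dg]; split=> [x Ax|v].
  exact: (differentiableD (df x Ax) (dg x Ax)).
apply: Ck_eq (IH _ _ (Df v) (Dg v)) => // x Ax.
by rewrite (derive_add (df x Ax) (dg x Ax)).
Qed.

Lemma Ck_mul {V} k (A : set V) (f g : V -> R) : open A ->
  Ck k A f -> Ck k A g -> Ck k A (fun x => f x * g x).
Proof.
move=> oA; elim: k f g => [|k IH] f g.
  by move=> cf cg x Ax; apply: cvgM; [exact: cf|exact: cg].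
move=> Cf Cg; have [df Df] := Cf; have [dg Dg] := Cg; split=> [x Ax|v].
  exact: (differentiableM (df x Ax) (dg x Ax)).
(* The product rule mixes undifferentiated and differentiated factors, so one order of regularity of
   [f] and [g] is dropped to match that of their derivatives. *)
apply: Ck_eq (Ck_add _ _ _ _ oA (IH _ _ (CkS_Ck _ _ _ Cf) (Dg v))
                                (IH _ _ (CkS_Ck _ _ _ Cg) (Df v))) => // x Ax.
by rewrite (derive_mul (df x Ax) (dg x Ax)).
Qed.

Lemma smooth_differentiable {V W} {A : set V} {f : V -> W} {x : V} :
  smooth A f -> A x -> differentiable f x.
Proof. by move=> /(_ 1%N)[df _]; exact: df. Qed.

Lemma smooth_subset {V W} {A B : set V} {f : V -> W} :
  B `<=` A -> smooth A f -> smooth B f.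
Proof. by move=> BA sf k; exact: Ck_subset (sf k). Qed.

Lemma smooth_eq {V W} {A : set V} {f g : V -> W} : open A ->
  (forall x, A x -> f x = g x) -> smooth A f -> smooth A g.
Proof. by move=> oA fg sf k; exact: Ck_eq (sf k). Qed.

Lemma smooth_linear_comp {V W W' : normedModType R} {A : set V} {f : V -> W}
    {l : W -> W'} : open A -> linear l -> continuous l ->
  smooth A f -> smooth A (fun x => l (f x)).
Proof. by move=> oA ll cl sf k; exact: Ck_linear_comp. Qed.

Lemma smooth_comp_linear {V V' W : normedModType R} {A : set V'} {f : V' -> W}
    {h : V -> V'} : linear h -> continuous h ->
  smooth A f -> smooth (h @^-1` A) (fun x => f (h x)).
Proof. by move=> lh ch sf k; exact: Ck_comp_linear. Qed.

Lemma smooth_add {V W} {A : set V} {f g : V -> W} : open A ->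
  smooth A f -> smooth A g -> smooth A (fun x => f x + g x).
Proof. by move=> oA sf sg k; exact: Ck_add. Qed.

Lemma smooth_opp {V W} {A : set V} {f : V -> W} : open A ->
  smooth A f -> smooth A (fun x => - f x).
Proof.
move=> oA; apply: smooth_linear_comp => //; last exact: opp_continuous.
by move=> a u v; rewrite opprD scalerN.
Qed.

Lemma smooth_sub {V W} {A : set V} {f g : V -> W} : open A ->
  smooth A f -> smooth A g -> smooth A (fun x => f x - g x).
Proof. by move=> oA sf sg; apply: smooth_add => //; exact: smooth_opp. Qed.

Lemma smooth_sum {V W} {I : Type} (s : seq I) {A : set V} {f : I -> V -> W} :
  open A -> (forall i, smooth A (f i)) -> smooth A (fun x => \sum_(i <- s) f i x).
Proof.
move=> oA sf; elim: s => [|i s IH].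
  by under eq_fun do rewrite big_nil; move=> k; exact: Ck_cst.
by under eq_fun do rewrite big_cons; exact: smooth_add.
Qed.

Lemma smooth_mul {V} {A : set V} {f g : V -> R} : open A ->
  smooth A f -> smooth A g -> smooth A (fun x => f x * g x).
Proof. by move=> oA sf sg k; exact: Ck_mul. Qed.

Lemma smooth_derive {V W} {A : set V} {f : V -> W} (v : V) :
  smooth A f -> smooth A (fun x => 'D_v f x).
Proof. by move=> sf k; have [_ Df] := sf k.+1; exact: Df. Qed.

Lemma smooth_id {V} (A : set V) : smooth A (fun x : V => x).
Proof.
move=> [|k] /=; first by move=> x _; exact: cvg_id.
split=> [x _|v]; first by have [] := is_diff_id x.
rewrite (_ : (fun x => 'D_v _ x) = fun=> v); first exact: Ck_cst.
by apply/funext => x; exact: derive_id.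
Qed.

Lemma linear_fst {V W} : linear (fst : V * W -> V).
Proof. by []. Qed.

Lemma linear_snd {V W} : linear (snd : V * W -> W).
Proof. by []. Qed.

Lemma continuous_fst {V W} : continuous (fst : V * W -> V).
Proof. by move=> x; exact: cvg_fst. Qed.

Lemma continuous_snd {V W} : continuous (snd : V * W -> W).
Proof. by move=> x; exact: cvg_snd. Qed.

Lemma smooth_pair {V W W' : normedModType R} {A : set V} {f : V -> W}
    {g : V -> W'} : open A ->
  smooth A f -> smooth A g -> smooth A (fun x => (f x, g x)).
Proof.
move=> oA sf sg.
(* Each summand is a smooth function followed by a continuous linear embedding into the product. *)
rewrite (_ : (fun x => (f x, g x)) = fun x => (f x, 0) + (0, g x)).
  apply: smooth_add => //.
    apply: (@smooth_linear_comp _ _ _ _ f (fun y => (y, 0))) => //.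
      by move=> a u v; apply: injective_projections; rewrite /= ?scaler0 ?addr0.
    by move=> y; apply: cvg_pair => //; exact: cvg_cst.
  apply: (@smooth_linear_comp _ _ _ _ g (fun y => (0, y))) => //.
    by move=> a u v; apply: injective_projections; rewrite /= ?scaler0 ?addr0.
  by move=> y; apply: cvg_pair => //; exact: cvg_cst.
by apply/funext => x; apply: injective_projections; rewrite /= ?addr0 ?add0r.
Qed.

(** A form of finite dimensionality that passes to products: finitely many vectors with continuous
    linear coordinate forms. Independence of the vectors [e] is not demanded, only reconstruction of
    every vector. *)
Definition finite_coordinates V := exists (I : finType) (e : I -> V) (c : I -> V -> R),
  (forall i, linear (c i) /\ continuous (c i)) /\ forall x, x = \sum_i c i x *: e i.

Lemma finite_coordinates_mx m n : finite_coordinates 'M[R]_(m, n).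
Proof.
exists ('I_m * 'I_n)%type, (fun ij => delta_mx ij.1 ij.2),
  (fun ij (M : 'M[R]_(m, n)) => M ij.1 ij.2).
split=> [ij|M]; first by split=> [a u v|]; [rewrite !mxE|exact: coord_continuous].
by rewrite {1}[M]matrix_sum_delta pair_bigA.
Qed.

Lemma finite_coordinates_prod {V W} :
  finite_coordinates V -> finite_coordinates W ->
  finite_coordinates (V * W)%type.
Proof.
move=> [I [e [c [lc ec]]]] [J [f [d [ld fd]]]].
exists (I + J)%type, (fun k => match k with inl i => (e i, 0) | inr j => (0, f j) end),
  (fun k x => match k with inl i => c i x.1 | inr j => d j x.2 end); split.
  move=> [i|j]; [have [l1 l2] := lc i|have [l1 l2] := ld j]; split.
  - by move=> a u v; exact: l1.
  - by move=> x; apply: continuous_comp; [exact: continuous_fst|exact: l2].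
  - by move=> a u v; exact: l1.
  - by move=> x; apply: continuous_comp; [exact: continuous_snd|exact: l2].
move=> [x y]; rewrite big_sumType; apply: injective_projections => /=.
  rewrite !(big_morph fst (fun _ _ => erefl) erefl) /= [X in _ + X]big1 ?addr0 //.
  by move=> j _; rewrite scaler0.
rewrite !(big_morph snd (fun _ _ => erefl) erefl) /= big1 ?add0r //.
by move=> i _; rewrite scaler0.
Qed.

Lemma finite_coordinates_real : finite_coordinates R.
Proof.
exists unit, (fun=> 1), (fun=> id); split=> [_|x].
  by split=> [//|x]; exact: cvg_id.
rewrite (big_pred1 tt); first exact/esym/mulr1.
by case.
Qed.

Lemma smooth_scale {V W} {A : set V} {f : V -> R} {g : V -> W} :
  finite_coordinates W -> open A ->
  smooth A f -> smooth A g -> smooth A (fun x => f x *: g x).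
Proof.
move=> [I [e [c [lc ec]]]] oA sf sg.
rewrite (_ : (fun x => f x *: g x) = fun x => \sum_i (f x * c i (g x)) *: e i).
  apply: smooth_sum => // i; have [l1 l2] := lc i.
  apply: (@smooth_linear_comp _ _ _ _ (fun x => f x * c i (g x)) ( *:%R^~ (e i))) => //.
  - by move=> a u v; rewrite scalerDl scalerA.
  - exact: scalel_continuous.
  - by apply: smooth_mul => //; apply: smooth_linear_comp.
apply/funext => x; rewrite {1}[g x]ec scaler_sumr.
by apply: eq_bigr => i _; rewrite scalerA.
Qed.

(** [Ck] differentiates only along constant vectors. Expanding [Z x] in coordinates turns a
    derivative along a vector field into a combination of constant-direction derivatives with smooth
    coefficients. *)
Lemma smooth_dir_derive {V W} {A : set V} {Z : V -> V} {f : V -> W} :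
  finite_coordinates V -> finite_coordinates W -> open A ->
  smooth A Z -> smooth A f -> smooth A (fun x => 'D_(Z x) f x).
Proof.
move=> [I [e [c [lc ec]]]] fW oA sZ sf.
apply: (@smooth_eq _ _ _ (fun x => \sum_i c i (Z x) *: 'D_(e i) f x)) => //.
  move=> x Ax; have df := smooth_differentiable sf Ax.
  rewrite {2}[Z x]ec derive_dir_sum//; apply: eq_bigr => i _.
  by rewrite derive_dirZ.
apply: smooth_sum => // i; have [l1 l2] := lc i.
by apply: smooth_scale => //; [exact: smooth_linear_comp|exact: smooth_derive].
Qed.

End SmoothFunctions.

(** * Calculus of matrix entries and of the pairing of rows with columns *)

Section RowColumnPairing.
Context {R : realType} {V : normedModType R} {n : nat}.
Implicit Types (u : V -> 'rV[R]_n) (th : V -> 'cV[R]_n).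

Lemma linear_coord {k l} (i : 'I_k) (j : 'I_l) :
  linear (fun M : 'M[R]_(k, l) => M i j).
Proof. by move=> a M N; rewrite !mxE. Qed.

Lemma differentiable_coord_comp {k l} {f : V -> 'M[R]_(k, l)} {x} i j :
  differentiable f x -> differentiable (fun y => f y i j) x.
Proof. by move=> df; apply: differentiable_comp df (differentiable_coord _ _ _). Qed.

Lemma derive_coord {k l} {f : V -> 'M[R]_(k, l)} {x v} i j :
  differentiable f x -> 'D_v (fun y => f y i j) x = 'D_v f x i j.
Proof.
move=> df.
exact: (derive_linear_comp (linear_coord i j) (@coord_continuous _ _ _ i j) df).
Qed.

Lemma differentiable_pairing {u th x} : differentiable u x -> differentiable th x ->
  differentiable (fun y => (u y *m th y) 0 0) x.
Proof.
move=> du dth; under eq_fun do rewrite mxE.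
by apply: differentiable_bigsum => k; apply: differentiableM;
  exact: differentiable_coord_comp.
Qed.

Lemma derive_pairing {u th x} v : differentiable u x -> differentiable th x ->
  'D_v (fun y => (u y *m th y) 0 0) x =
  ('D_v u x *m th x) 0 0 + (u x *m 'D_v th x) 0 0.
Proof.
move=> du dth; under eq_fun do rewrite mxE.
have dc k := differentiableM (differentiable_coord_comp 0 k du)
                             (differentiable_coord_comp k 0 dth).
rewrite (derive_bigsum dc) !mxE -big_split; apply: eq_bigr => k _ /=.
rewrite (derive_mul (differentiable_coord_comp 0 k du)
                    (differentiable_coord_comp k 0 dth)).
by rewrite !derive_coord//; ring.
Qed.

Lemma smooth_coord {k l} {A : set V} {f : V -> 'M[R]_(k, l)} i j :
  open A -> smooth A f -> smooth A (fun x => f x i j).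
Proof.
move=> oA.
exact: (smooth_linear_comp oA (linear_coord i j) (@coord_continuous _ _ _ i j)).
Qed.

Lemma smooth_pairing {A : set V} {u th} : open A ->
  smooth A u -> smooth A th -> smooth A (fun x => (u x *m th x) 0 0).
Proof.
move=> oA su sth; under eq_fun do rewrite mxE.
by apply: smooth_sum => // k; apply: smooth_mul => //; exact: smooth_coord.
Qed.

Lemma smooth_row {A : set V} {f : 'I_n -> V -> R} : open A ->
  (forall i, smooth A (f i)) -> smooth A (fun x => \row_i f i x).
Proof.
move=> oA sf.
rewrite (_ : (fun x => _) = fun x => \sum_i f i x *: delta_mx 0 i); last first.
  by apply/funext => x; rewrite [LHS]row_sum_delta; apply: eq_bigr => i _; rewrite mxE.
apply: smooth_sum => // i.
apply: (@smooth_linear_comp _ _ _ _ _ (f i) ( *:%R^~ (delta_mx 0 i))) => //.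
  by move=> a x y; rewrite scalerDl scalerA.
exact: scalel_continuous.
Qed.

End RowColumnPairing.

(** * Smoothness of the frame data and of the derivatives of [L] along the lifts *)

Section FrameSmoothness.
Context {R : realType} {m p : nat}.
Context {U : set 'rV[R]_(m + p)} {D : 'rV[R]_(m + p) -> {vspace 'rV[R]_(m + p)}}.
Context {X : 'I_(m + p) -> 'rV[R]_(m + p) -> 'rV[R]_(m + p)}.
Context {theta : 'I_(m + p) -> 'rV[R]_(m + p) -> 'cV[R]_(m + p)}.
Context {L : 'rV[R]_(m + p) * 'rV[R]_(m + p) -> R}.
Context (hU : open U) (sX : forall i, smooth U (X i)).
Context (sth : forall i, smooth U (theta i)) (sL : smooth (tangent_bundle U) L).

Lemma open_tangent_bundle : open (tangent_bundle U).
Proof.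
rewrite (_ : tangent_bundle U = fst @^-1` U); last first.
  by apply/seteqP; split=> [w []|].
by apply: open_comp => // w _; exact: continuous_fst.
Qed.

Lemma smooth_base {W : normedModType R} {f : 'rV[R]_(m + p) -> W} :
  smooth U f -> smooth (tangent_bundle U) (fun w => f w.1).
Proof.
move=> sf; apply: (smooth_subset _ (smooth_comp_linear linear_fst continuous_fst sf)).
by move=> w [].
Qed.

Lemma smooth_snd : smooth (tangent_bundle U) snd.
Proof.
have oT := open_tangent_bundle; have s0 := smooth_id (tangent_bundle U).
exact: (smooth_linear_comp oT linear_snd continuous_snd s0).
Qed.

Let fcE : finite_coordinates 'rV[R]_(m + p) := finite_coordinates_mx 1 (m + p).
Let fcR : finite_coordinates R := finite_coordinates_real.

Lemma smooth_vert_deriv i : smooth (tangent_bundle U) (vert_deriv X L i).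
Proof.
have oT := open_tangent_bundle.
apply: smooth_dir_derive => //; first exact: finite_coordinates_prod.
by apply: smooth_pair => //; [move=> k; exact: Ck_cst|exact: smooth_base].
Qed.

Lemma smooth_comp_deriv i : smooth (tangent_bundle U) (comp_deriv X L i).
Proof.
have oT := open_tangent_bundle.
apply: smooth_dir_derive => //; first exact: finite_coordinates_prod.
apply: smooth_pair => //; first exact: smooth_base.
(* The fibre part of the complete lift is rewritten as the derivative of the pullback of [X i] to
   $TQ$ along the smooth vector field [(w.2, 0)], so that [smooth_dir_derive] applies on $TQ$. *)
rewrite (_ : (fun w => 'D_(w.2) _ w.1) =
             fun w => 'D_((w.2, 0)) (fun y => X i y.1) w); last first.
  by apply/funext => w; rewrite (derive_comp_linear linear_fst).
apply: smooth_dir_derive => //; [exact: finite_coordinates_prod| |exact: smooth_base].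
apply: smooth_pair => //; [exact: smooth_snd|move=> k; exact: Ck_cst].
Qed.

Lemma smooth_quasi_velocity i : smooth (tangent_bundle U) (quasi_velocity theta i).
Proof.
exact: (smooth_pairing open_tangent_bundle smooth_snd (smooth_base (sth i))).
Qed.

Lemma smooth_struct_fun k i j : smooth U (struct_fun X theta k i j).
Proof.
apply: smooth_pairing => //; apply: smooth_sub => //;
  apply: smooth_dir_derive => //; exact: finite_coordinates_mx.
Qed.

End FrameSmoothness.

(** * Linearity of the evaluation of covectors *)

Section Pairing.
Context {R : realType} {n : nat}.
Implicit Types (th : 'rV[R]_n -> 'cV[R]_n) (q u v : 'rV[R]_n).

Lemma covec_appD th q u v : covec_app th q (u + v) = covec_app th q u + covec_app th q v.
Proof. by rewrite /covec_app mulmxDl mxE. Qed.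

Lemma covec_appN th q u : covec_app th q (- u) = - covec_app th q u.
Proof. by rewrite /covec_app mulNmx mxE. Qed.

Lemma covec_appB th q u v : covec_app th q (u - v) = covec_app th q u - covec_app th q v.
Proof. by rewrite covec_appD covec_appN. Qed.

Lemma covec_appZ th q a u : covec_app th q (a *: u) = a * covec_app th q u.
Proof. by rewrite /covec_app -scalemxAl mxE. Qed.

Lemma covec_app_sum (I : Type) (s : seq I) th q (f : I -> 'rV[R]_n) :
  covec_app th q (\sum_(i <- s) f i) = \sum_(i <- s) covec_app th q (f i).
Proof. by rewrite /covec_app mulmx_suml summxE. Qed.

End Pairing.

(** * Adapted frame, dual coframe and quasi-velocities *)

Section AdaptedFrame.
Context {R : realType} {m p : nat}.
Context {U : set 'rV[R]_(m + p)} {D : 'rV[R]_(m + p) -> {vspace 'rV[R]_(m + p)}}.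
Context {X : 'I_(m + p) -> 'rV[R]_(m + p) -> 'rV[R]_(m + p)}.
Context {theta : 'I_(m + p) -> 'rV[R]_(m + p) -> 'cV[R]_(m + p)}.
Context (hU : open U) (hX : adapted_frame U D X) (hth : dual_coframe U X theta).

(** The basis property supplies some coefficients; applying $\theta^j$ and duality identifies the
    one of $X_j$. *)
Lemma frame_expansion q v : U q ->
  v = \sum_i covec_app (theta i) q v *: X i q.
Proof.
move=> Uq; have [/coord_basis bX _] := hX.2 q Uq.
have {bX} [c vE] : exists c : 'I_(m + p) -> R, v = \sum_i c i *: X i q.
  exists (fun i => coord [tuple X i q | i < m + p] i v).
  rewrite {1}(bX v (memvf v)); apply: eq_bigr => i _.
  by rewrite -tnth_nth tnth_mktuple.
rewrite {1}vE; apply: eq_bigr => j _; congr (_ *: _).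
rewrite vE covec_app_sum (bigD1 j)//= covec_appZ hth.2// eqxx mulr1.
rewrite big1 ?addr0// => i /negPf ij.
by rewrite covec_appZ hth.2// eq_sym ij mulr0.
Qed.

(** The velocity is a combination of the $X_\alpha$, and each $\theta^a$ annihilates them. *)
Lemma quasi_velocity_eq0 w a : constraint_set U D w ->
  quasi_velocity theta (rshift m a) w = 0.
Proof.
move=> [Uq]; have [_ ->] := hX.2 _ Uq; move=> /coord_span uE.
rewrite /quasi_velocity uE covec_app_sum big1// => al _.
rewrite covec_appZ -tnth_nth tnth_mktuple hth.2//.
by rewrite eq_sym eq_lrshift mulr0.
Qed.

Lemma velocity_expansion w : constraint_set U D w ->
  w.2 = \sum_(al < m) quasi_velocity theta (lshift p al) w *: X (lshift p al) w.1.
Proof.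
move=> Cw; rewrite {1}(frame_expansion w.1 w.2 Cw.1) big_split_ord /=.
rewrite [X in _ + X]big1 ?addr0// => a _.
by rewrite [covec_app _ _ _](quasi_velocity_eq0 w a Cw) scale0r.
Qed.

(* The functions theta^i(X_j) are constant. *)
Lemma derive_coframe_frame i j q v : U q ->
  covec_app ('D_v (theta i)) q (X j q) = - covec_app (theta i) q ('D_v (X j) q).
Proof.
move=> Uq.
have dX := smooth_differentiable (hX.1 j) Uq.
have dth := smooth_differentiable (hth.1 i) Uq.
apply/eqP; rewrite -addr_eq0 addrC; apply/eqP.
rewrite -(derive_pairing v dX dth).
rewrite -(derive_cst ((i == j)%:R : R) q v).
apply: near_eq_derive; near=> y; apply: hth.2.
by near: y; exact: open_nbhs_nbhs.
Unshelve. all: by end_near.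
Qed.

End AdaptedFrame.

(** * The vakonomic 2-form and the differential of the energy *)

Section VakonomicForm.
Context {R : realType} {m p : nat}.
Context {U : set 'rV[R]_(m + p)} {D : 'rV[R]_(m + p) -> {vspace 'rV[R]_(m + p)}}.
Context {X : 'I_(m + p) -> 'rV[R]_(m + p) -> 'rV[R]_(m + p)}.
Context {theta : 'I_(m + p) -> 'rV[R]_(m + p) -> 'cV[R]_(m + p)}.
Context {L : 'rV[R]_(m + p) * 'rV[R]_(m + p) -> R}.
Context (hU : open U) (hX : adapted_frame U D X) (hth : dual_coframe U X theta)
  (sL : smooth (tangent_bundle U) L).
Local Notation TQ := ('rV[R]_(m + p) * 'rV[R]_(m + p))%type.
Implicit Types (w : TQ) (z zeta xi : TQ * 'rV[R]_p) (i j : 'I_(m + p)).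

(* mu_a with its index extended by zero to the Greek range. *)
Definition multiplier_coord i z : R := row_mx (0 : 'rV[R]_m) z.2 0 i.

(** The coefficient of $\theta^i$ in the 1-form whose differential is $\hat\omega$; the padded
    multiplier treats Greek and Latin indices uniformly. *)
Definition momentum i z : R := vert_deriv X L i z.1 - multiplier_coord i z.

Lemma linear_multiplier_coord i : linear (multiplier_coord i).
Proof.
move=> a z z'; rewrite /multiplier_coord; case: (split_ordP i) => k ->.
  by rewrite !row_mxEl !mxE scaler0 addr0.
by rewrite !row_mxEr !mxE.
Qed.

Lemma continuous_multiplier_coord i : continuous (multiplier_coord i).
Proof.
rewrite /multiplier_coord; case: (split_ordP i) => k ->.
  by under eq_fun do rewrite row_mxEl mxE; exact: cst_continuous.
under eq_fun do rewrite row_mxEr.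
move=> z; apply: (@continuous_comp _ _ _ snd (fun M : 'rV[R]_p => M 0 k)).
  exact: continuous_snd.
exact: coord_continuous.
Qed.

Lemma vak_formE z xi : vak_form X theta L z xi =
  \sum_i momentum i z * covec_app (theta i) z.1.1 xi.1.1.
Proof.
under eq_bigr do rewrite mulrBl.
rewrite big_split /= sumrN; congr (_ - _).
rewrite [RHS]big_split_ord /= [X in _ = X + _]big1 ?add0r => [|k _].
  by apply: eq_bigr => a _; rewrite /multiplier_coord row_mxEr.
by rewrite /multiplier_coord row_mxEl mxE mul0r.
Qed.

Section AtPoint.
Context {z : TQ * 'rV[R]_p} (Uz : U z.1.1).

Let Tz : tangent_bundle U z.1. Proof. by split. Qed.

Let dfst : differentiable (fst : TQ * 'rV[R]_p -> TQ) z.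
Proof. by have [] := is_diff_linear z linear_fst continuous_fst. Qed.

Let dp i : differentiable (vert_deriv X L i) z.1.
Proof. exact: smooth_differentiable (smooth_vert_deriv hU hX.1 sL i) Tz. Qed.

Let dmu i : is_diff z (multiplier_coord i) (multiplier_coord i).
Proof.
exact: is_diff_linear z (linear_multiplier_coord i) (continuous_multiplier_coord i).
Qed.

Lemma differentiable_momentum i : differentiable (momentum i) z.
Proof.
have [dm _] := dmu i.
by apply: differentiableB => //; exact: (differentiable_comp dfst (dp i)).
Qed.

Lemma derive_momentum i xi :
  'D_xi (momentum i) z = 'D_(xi.1) (vert_deriv X L i) z.1 - multiplier_coord i xi.
Proof.
have [dm dmE] := dmu i; have dmN := differentiableN dm.
have Dm : 'D_xi (multiplier_coord i) z = multiplier_coord i xi by rewrite deriveE// dmE.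
rewrite (derive_add (differentiable_comp dfst (dp i)) dmN) (derive_opp dm).
by rewrite (derive_comp_linear linear_fst) Dm.
Qed.

Lemma derive_covec_app i xi v :
  differentiable (fun y => covec_app (theta i) y.1.1 v) z /\
  'D_xi (fun y => covec_app (theta i) y.1.1 v) z =
  covec_app ('D_(xi.1.1) (theta i)) z.1.1 v.
Proof.
have dth := smooth_differentiable (hth.1 i) Uz.
have dv := differentiable_cst v z.1.1.
have [df1 _] := is_diff_linear z.1 linear_fst continuous_fst.
split; first exact: (differentiable_comp dfst
  (differentiable_comp df1 (differentiable_pairing dv dth))).
rewrite (derive_comp_linear (f := fun w => covec_app (theta i) w.1 v) linear_fst).
rewrite (derive_comp_linear (f := fun q => covec_app (theta i) q v) linear_fst).
by rewrite (derive_pairing _ dv dth) derive_cst mul0mx mxE add0r.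
Qed.

(** With $p_i$ for [momentum i], this is $dp_i\wedge\theta^i+p_i\,d\theta^i$ evaluated on two frozen
    vectors: the product rule gives the first sum, and exchanging the arguments gives the second. *)
Lemma ext_d_vak_form zeta xi : ext_d (vak_form X theta L) z zeta xi =
  \sum_i (('D_(zeta.1) (vert_deriv X L i) z.1 - multiplier_coord i zeta) *
            covec_app (theta i) z.1.1 xi.1.1 +
          momentum i z * covec_app ('D_(zeta.1.1) (theta i)) z.1.1 xi.1.1) -
  \sum_i (('D_(xi.1) (vert_deriv X L i) z.1 - multiplier_coord i xi) *
            covec_app (theta i) z.1.1 zeta.1.1 +
          momentum i z * covec_app ('D_(xi.1.1) (theta i)) z.1.1 zeta.1.1).
Proof.
have D1 e e' : 'D_e (fun y => vak_form X theta L y e') z =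
    \sum_i (('D_(e.1) (vert_deriv X L i) z.1 - multiplier_coord i e) *
            covec_app (theta i) z.1.1 e'.1.1 +
          momentum i z * covec_app ('D_(e.1.1) (theta i)) z.1.1 e'.1.1).
  under eq_fun do rewrite vak_formE.
  have dc i := (derive_covec_app i e e'.1.1).1.
  have dm := differentiable_momentum.
  rewrite (derive_bigsum (fun i => differentiableM (dm i) (dc i))).
  apply: eq_bigr => i _; rewrite (derive_mul (dm i) (dc i)) (derive_covec_app _ _ _).2.
  by rewrite derive_momentum addrC; congr (_ + _); exact: mulrC.
by rewrite /ext_d !D1.
Qed.

(** In the product rule, the derivative of $v^i$ splits into a base part, which differentiates
    $\theta^i$, and a fibre part, the value of $\theta^i$ on [xi.1.2]. *)
Lemma derive_energy xi : 'D_xi (energy X theta L) z =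
  \sum_i (quasi_velocity theta i z.1 * 'D_(xi.1) (vert_deriv X L i) z.1 +
    vert_deriv X L i z.1 * (covec_app ('D_(xi.1.1) (theta i)) z.1.1 z.1.2 +
                            covec_app (theta i) z.1.1 xi.1.2)) - 'D_(xi.1) L z.1.
Proof.
have dL := smooth_differentiable sL Tz.
have dth i := smooth_differentiable (smooth_base (hth.1 i)) Tz.
have [dsnd _] := is_diff_linear z.1 linear_snd continuous_snd.
have dv i : differentiable (quasi_velocity theta i) z.1.
  exact: differentiable_pairing.
have ds : differentiable (fun w => \sum_i quasi_velocity theta i w * vert_deriv X L i w) z.1.
  by apply: differentiable_bigsum => i; exact: (differentiableM (dv i) (dp i)).
rewrite (derive_comp_linear (f := fun w =>
  (\sum_i quasi_velocity theta i w * vert_deriv X L i w) - L w) linear_fst).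
have dLN := differentiableN dL.
rewrite (derive_add ds dLN) (derive_opp dL); congr (_ - _).
rewrite (derive_bigsum (fun i => differentiableM (dv i) (dp i))).
apply: eq_bigr => i _; rewrite (derive_mul (dv i) (dp i)); congr (_ + _ * _).
rewrite (derive_pairing xi.1 dsnd (dth i)) [RHS]addrC; congr (_ + _).
by rewrite (derive_comp_linear (f := id) linear_snd) derive_id.
Qed.

End AtPoint.

End VakonomicForm.

(** * Reduction of the vakonomic equations to one scalar equation per frame field *)

Section VakonomicResidual.
Context {R : realType} {m p : nat}.
Context {U : set 'rV[R]_(m + p)} {D : 'rV[R]_(m + p) -> {vspace 'rV[R]_(m + p)}}.
Context {X : 'I_(m + p) -> 'rV[R]_(m + p) -> 'rV[R]_(m + p)}.
Context {theta : 'I_(m + p) -> 'rV[R]_(m + p) -> 'cV[R]_(m + p)}.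
Context {L : 'rV[R]_(m + p) * 'rV[R]_(m + p) -> R}.
Context (hU : open U) (hX : adapted_frame U D X) (hth : dual_coframe U X theta)
  (sL : smooth (tangent_bundle U) L).
Local Notation TQ := ('rV[R]_(m + p) * 'rV[R]_(m + p))%type.
Implicit Types (w : TQ) (z zeta xi : TQ * 'rV[R]_p) (i j : 'I_(m + p)).

(* The left-hand side is mu_b dtheta^b(u, X_j); as u = v^be X_be on C, it only
   involves dtheta^b(X_be, X_j) = - theta^b([X_be, X_j]). *)
Lemma multiplier_ext_d z j : constraint_set U D z.1 ->
  \sum_i multiplier_coord i z *
     (covec_app ('D_(z.1.2) (theta i)) z.1.1 (X j z.1.1) -
      covec_app ('D_(X j z.1.1) (theta i)) z.1.1 z.1.2) =
  \sum_(b < p) \sum_(be < m) z.2 0 b *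
     struct_fun X theta (rshift m b) j (lshift p be) z.1.1 *
     quasi_velocity theta (lshift p be) z.1.
Proof.
move=> Cz; have Uz := Cz.1.
rewrite big_split_ord /= big1 ?add0r => [|k _]; last first.
  by rewrite /multiplier_coord row_mxEl mxE mul0r.
apply: eq_bigr => b _; rewrite /multiplier_coord row_mxEr.
under [RHS]eq_bigr do rewrite -mulrA.
rewrite -mulr_sumr; congr (_ * _).
have dX := smooth_differentiable (hX.1 j) Uz.
transitivity (- (covec_app (theta (rshift m b)) z.1.1 ('D_(z.1.2) (X j) z.1.1) +
    covec_app ('D_(X j z.1.1) (theta (rshift m b))) z.1.1 z.1.2)).
  rewrite opprD; congr (_ - _); exact: (derive_coframe_frame hU hX hth _ _ _ _ Uz).
rewrite {1 2}(velocity_expansion hX hth _ Cz) (derive_dir_sum dX).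
rewrite !covec_app_sum -big_split -sumrN; apply: eq_bigr => be _ /=.
rewrite (derive_dirZ _ dX) !covec_appZ /struct_fun /bracket covec_appB.
(* The derivative of $\theta^b$ along $X_j$, paired with $X_\beta$, is traded for the derivative of
   $X_\beta$; this completes the bracket $[X_j,X_\beta]$. *)
have swap (A B C v : R) : B = - C -> - (v * A + v * B) = (C - A) * v by move=> ->; ring.
exact/swap/(derive_coframe_frame hU hX hth _ _ _ _ Uz).
Qed.

(** The algebra behind [vakonomic_residual]. There [c] and [t] are the frame components of the base
    and fibre parts of [xi], [P] and [K] are the vertical and complete derivatives of [L], [dP] and
    [dxP] are the derivatives of [P] along [zeta] and [xi], and [mu], [nu], [mux] are the padded
    multiplier parts of [z], [zeta], [xi]. The terms in [a] and [b] come from the coframe, and [M]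
    is the structure-function term. *)
Let residual_sum (I : finType) (c P K mu nu mux v dP dxP a b t M : I -> R) (T : I -> I -> R) :
  (forall k, mux k * v k = 0) ->
  (forall k, \sum_l c l * T k l = - a k) ->
  \sum_k c k * M k = \sum_k mu k * (a k - b k) ->
  \sum_k ((dP k - nu k) * c k + (P k - mu k) * a k) -
  \sum_k ((dxP k - mux k) * v k + (P k - mu k) * b k) +
  (\sum_k (v k * dxP k + P k * (b k + t k)) -
   (\sum_l c l * K l + \sum_k (t k - \sum_l c l * T k l) * P k)) =
  \sum_l c l * (dP l - K l - nu l - M l).
Proof.
move=> mv aE ME; under [RHS]eq_bigr do rewrite mulrBr.
rewrite [RHS]big_split sumrN ME opprD /= -!sumrN -!big_split; apply: eq_bigr => k _ /=.
by rewrite aE [(_ - mux k) * _]mulrBl mv; ring.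
Qed.

Lemma derive_lagrangian w (xi : TQ) : U w.1 -> 'D_xi L w =
  \sum_j covec_app (theta j) w.1 xi.1 * comp_deriv X L j w +
  \sum_i (covec_app (theta i) w.1 xi.2 -
    \sum_j covec_app (theta j) w.1 xi.1 * covec_app (theta i) w.1 ('D_(w.2) (X j) w.1)) *
    vert_deriv X L i w.
Proof.
move=> Uw; have dL : differentiable L w by exact: (smooth_differentiable sL (conj Uw I)).
(* Complete and vertical lifts of a frame together span the tangent vectors to $TQ$: the complete
   lifts account for the base part of [xi], and [r] is the fibre part left for the vertical
   lifts. *)
pose r := xi.2 - \sum_j covec_app (theta j) w.1 xi.1 *: 'D_(w.2) (X j) w.1.
have {1}-> : xi = \sum_j covec_app (theta j) w.1 xi.1 *: complete_lift (X j) w +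
                  \sum_i covec_app (theta i) w.1 r *: vertical_lift (X i) w.
  apply: injective_projections => /=.
    rewrite !(big_morph fst (fun _ _ => erefl) erefl) /=.
    rewrite -(frame_expansion hX hth _ _ Uw) big1 ?addr0// => i _.
    by rewrite scaler0.
  rewrite !(big_morph snd (fun _ _ => erefl) erefl) /=.
  by rewrite -(frame_expansion hX hth _ _ Uw) addrC subrK.
rewrite (derive_dirD dL) !(derive_dir_sum dL); congr (_ + _).
  by apply: eq_bigr => j _; rewrite (derive_dirZ _ dL).
apply: eq_bigr => i _; rewrite (derive_dirZ _ dL) covec_appB covec_app_sum.
by under [in LHS]eq_bigr do rewrite covec_appZ.
Qed.

(* The value of zeta _| omega + dE on the complete lift of X_j. *)
Definition residual z zeta j :=
  'D_(zeta.1) (vert_deriv X L j) z.1 - comp_deriv X L j z.1 -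
  multiplier_coord j zeta -
  \sum_(b < p) \sum_(be < m) z.2 0 b *
     struct_fun X theta (rshift m b) j (lshift p be) z.1.1 *
     quasi_velocity theta (lshift p be) z.1.

(** Only the base part of [xi] survives. By the second-order condition the derivatives of
    $X_i^{\mathrm V}(L)$ along [xi] cancel between $\hat\omega$ and $dE$, the fibre terms of $dE$
    cancel among themselves, and the multiplier part of [xi] meets only $v^a=0$. *)
Lemma vakonomic_residual z zeta xi : constraint_set U D z.1 -> zeta.1.1 = z.1.2 ->
  ext_d (vak_form X theta L) z zeta xi + 'D_xi (energy X theta L) z =
  \sum_j covec_app (theta j) z.1.1 xi.1.1 * residual z zeta j.
Proof.
move=> Cz zeta1; have Uz := Cz.1.
rewrite (ext_d_vak_form hU hX hth sL Uz) (derive_energy hU hX hth sL Uz).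
rewrite (derive_lagrangian _ _ Uz) zeta1.
pose c j := covec_app (theta j) z.1.1 xi.1.1.
have xiE : xi.1.1 = \sum_j c j *: X j z.1.1 := frame_expansion hX hth _ _ Uz.
have mv i : multiplier_coord i xi * quasi_velocity theta i z.1 = 0.
  rewrite /multiplier_coord; case: (split_ordP i) => k ->.
    by rewrite row_mxEl mxE mul0r.
  by rewrite (quasi_velocity_eq0 hX hth _ _ Cz) mulr0.
pose a i := covec_app ('D_(z.1.2) (theta i)) z.1.1 xi.1.1.
pose b i := covec_app ('D_(xi.1.1) (theta i)) z.1.1 z.1.2.
(* The [c j] are numbers fixed at the point [z], so constancy of each $\theta^i(X_j)$ applies term
   by term. *)
have aE i : \sum_j c j * covec_app (theta i) z.1.1 ('D_(z.1.2) (X j) z.1.1) = - a i.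
  rewrite /a {1}xiE covec_app_sum -sumrN; apply: eq_bigr => j _.
  by rewrite covec_appZ (derive_coframe_frame hU hX hth _ _ _ _ Uz) mulrN opprK.
have bE i : \sum_j c j * covec_app ('D_(X j z.1.1) (theta i)) z.1.1 z.1.2 = b i.
  have dth := smooth_differentiable (hth.1 i) Uz.
  rewrite /b /covec_app {1}xiE (derive_dir_sum dth) mulmx_sumr summxE.
  apply: eq_bigr => j _.
  by rewrite (derive_dirZ _ dth) -scalemxAr [RHS]mxE.
have abE i : a i - b i = \sum_j c j *
    (covec_app ('D_(z.1.2) (theta i)) z.1.1 (X j z.1.1) -
     covec_app ('D_(X j z.1.1) (theta i)) z.1.1 z.1.2).
  under eq_bigr do rewrite mulrBr.
  rewrite sumrB; congr (_ - _); last exact/esym/bE.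
  rewrite /a {1}xiE covec_app_sum; apply: eq_bigr => j _; exact: covec_appZ.
have M : \sum_j c j * (\sum_(b < p) \sum_(be < m) z.2 0 b *
     struct_fun X theta (rshift m b) j (lshift p be) z.1.1 *
     quasi_velocity theta (lshift p be) z.1) =
     \sum_i multiplier_coord i z * (a i - b i).
  under eq_bigr do rewrite -(multiplier_ext_d _ _ Cz) mulr_sumr.
  rewrite exchange_big; apply: eq_bigr => i _ /=.
  by rewrite abE mulr_sumr; apply: eq_bigr => j _; rewrite mulrCA.
exact: residual_sum.
Qed.

Lemma vakonomic_eqP z zeta : constraint_set U D z.1 -> zeta.1.1 = z.1.2 ->
  vakonomic_eq X theta L z zeta <-> forall j, residual z zeta j = 0.
Proof.
move=> Cz zeta1; split=> [vak j|res xi]; last first.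
  apply/eqP; rewrite -addr_eq0 vakonomic_residual// big1// => j _.
  by rewrite res mulr0.
(* As only the base part of the test vector counts, any lift of $X_j$ isolates the residual of index
   [j]; the one with zero fibre and multiplier parts is taken. *)
have := vakonomic_residual z zeta ((X j z.1.1, 0), 0) Cz zeta1.
rewrite vak addNr (bigD1 j)//= hth.2 ?eqxx ?mul1r; last exact: Cz.1.
rewrite big1 ?addr0// => i /negPf ij.
by rewrite hth.2 ?ij ?mul0r//; exact: Cz.1.
Qed.

End VakonomicResidual.

(** * Vakonomic equations along a section, with nonholonomic $TQ$-component *)

Section Consistency.
Context {R : realType} {m p : nat}.
Context {U : set 'rV[R]_(m + p)} {D : 'rV[R]_(m + p) -> {vspace 'rV[R]_(m + p)}}.
Context {X : 'I_(m + p) -> 'rV[R]_(m + p) -> 'rV[R]_(m + p)}.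
Context {theta : 'I_(m + p) -> 'rV[R]_(m + p) -> 'cV[R]_(m + p)}.
Context {L : 'rV[R]_(m + p) * 'rV[R]_(m + p) -> R}.
Context {Gam : 'rV[R]_(m + p) * 'rV[R]_(m + p) -> 'rV[R]_(m + p) * 'rV[R]_(m + p)}.
Context (hU : open U) (hX : adapted_frame U D X) (hth : dual_coframe U X theta)
  (sL : smooth (tangent_bundle U) L) (hGam : nonholonomic_dynamics U D X L Gam).
Implicit Types (phi : 'rV[R]_(m + p) * 'rV[R]_(m + p) -> 'rV[R]_p).
Local Notation C := (constraint_set U D).

Definition reaction phi (al : 'I_m) w : R :=
  \sum_(a < p) \sum_(be < m) phi w 0 a *
    struct_fun X theta (rshift m a) (lshift p al) (lshift p be) w.1 *
    quasi_velocity theta (lshift p be) w.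

(** The Greek residuals do not involve [nu], and the nonholonomic equations reduce them to minus
    [reaction]. Each Latin residual is the difference between a $\partial/\partial\mu_a$ component
    of [Gam_bar] and that of [nu]. *)
Lemma vakonomic_nonholonomicP phi w nu : C w ->
  vakonomic_eq X theta L (w, phi w) (Gam w, nu) <->
  (forall al, reaction phi al w = 0) /\
  nu = (Gam_bar X theta L Gam phi (w, phi w)).2.
Proof.
move=> Cw; have [Gam1 _ EL0] := hGam.2 w Cw.
rewrite (vakonomic_eqP hU hX hth sL (w, phi w) (Gam w, nu) Cw Gam1).
have resl al : residual (X := X) (theta := theta) (L := L)
    (w, phi w) (Gam w, nu) (lshift p al) = - reaction phi al w.
  rewrite /residual /multiplier_coord row_mxEl mxE subr0.
  by rewrite -[X in X - _]/(EL_expr X L Gam (lshift p al) w) EL0 sub0r.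
have resr a : residual (X := X) (theta := theta) (L := L)
    (w, phi w) (Gam w, nu) (rshift m a) =
    (Gam_bar X theta L Gam phi (w, phi w)).2 0 a - nu 0 a.
  by rewrite /residual /multiplier_coord row_mxEr [in RHS]mxE addrAC.
split=> [res|[re0 nuE] j].
  split=> [al|]; first by apply/eqP; rewrite -oppr_eq0 -resl res.
  by apply/rowP => a; apply/eqP; rewrite eq_sym -subr_eq0 -resr res.
case: (split_ordP j) => k ->; first by rewrite resl re0 oppr0.
by rewrite resr -nuE subrr.
Qed.

Lemma smooth_on_Gam_bar phi : is_section U D phi ->
  smooth_on (im_section U D phi) (Gam_bar X theta L Gam phi).
Proof.
move=> sphi z [w Cw <-].
have [A1 [G [opA1 A1w sG GamE]]] := hGam.1 w Cw.
have [A2 [f [opA2 A2w sf fE]]] := sphi w Cw.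
have oT := open_tangent_bundle (m := m) (p := p) hU.
pose A := A1 `&` (A2 `&` tangent_bundle U).
have opA : open A by apply: openI => //; exact: openI.
have AT : A `<=` tangent_bundle U by move=> ? [_ []].
(* The formula of [Gam_bar] with [Gam] and [phi] replaced by local smooth extensions [G] and [f]. It
   depends on the $TQ$-component only, so composing it with the projection gives the required
   extension off $\operatorname{im}(\phi)$. *)
pose F w : _ * 'rV[R]_p := (G w, \row_a ('D_(G w) (vert_deriv X L (rshift m a)) w -
  comp_deriv X L (rshift m a) w -
     \sum_(b < p) \sum_(al < m) f w 0 b *
       struct_fun X theta (rshift m b) (rshift m a) (lshift p al) w.1 *
       quasi_velocity theta (lshift p al) w)).
have sGA : smooth A G by apply: smooth_subset sG => ? [].
have sfA : smooth A f by apply: smooth_subset sf => ? [_ []].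
exists (fst @^-1` A), (fun z => F z.1); split.
- by apply: open_comp => // ? _; exact: continuous_fst.
- by split=> //; split=> //; split=> //; exact: Cw.1.
- apply: (smooth_comp_linear linear_fst continuous_fst).
  apply: smooth_pair => //; apply: smooth_row => // a; apply: smooth_sub => //.
    apply: smooth_sub => //.
      apply: smooth_dir_derive => //.
      + by apply: finite_coordinates_prod; exact: finite_coordinates_mx.
      + exact: finite_coordinates_real.
      + exact: smooth_subset AT (smooth_vert_deriv hU hX.1 sL _).
    exact: smooth_subset AT (smooth_comp_deriv hU hX.1 sL _).
  apply: smooth_sum => // b; apply: smooth_sum => // al.
  apply: smooth_mul => //; last exact: smooth_subset AT (smooth_quasi_velocity hU hth.1 _).
  apply: smooth_mul => //; first exact: smooth_coord.
  apply: smooth_subset AT _.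
  exact: smooth_base (smooth_struct_fun hU hX.1 hth.1 _ _ _).
- move=> _ [y Cy <-] [A1y [A2y _]].
  have GamEy : Gam y = G y by exact: GamE.
  have fEy : phi y = f y by exact: fE.
  by rewrite /Gam_bar /F /multiplier /EL_expr /apply_vf /= GamEy fEy.
Qed.

End Consistency.

(** * Equivalence of weak consistency, reaction-freeness and solvability by [Gam_bar] *)

Theorem theorem2 (R : realType) (m p : nat) (U : set 'rV[R]_(m + p))
    (D : 'rV[R]_(m + p) -> {vspace 'rV[R]_(m + p)})
    (X : 'I_(m + p) -> 'rV[R]_(m + p) -> 'rV[R]_(m + p))
    (theta : 'I_(m + p) -> 'rV[R]_(m + p) -> 'cV[R]_(m + p))
    (L : 'rV[R]_(m + p) * 'rV[R]_(m + p) -> R)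
    (Gam : 'rV[R]_(m + p) * 'rV[R]_(m + p) -> 'rV[R]_(m + p) * 'rV[R]_(m + p))
    (hU : open U)
    (hX : adapted_frame U D X)
    (hD : ~ integrable_distribution U D)
    (htheta : dual_coframe U X theta)
    (hL : smooth (tangent_bundle U) L)
    (hreg : regular U X L)
    (hregD : regular_wrt_D U D X L)
    (hregDperp : regular_wrt_Dperp U D X L)
    (hGam : nonholonomic_dynamics U D X L Gam) :
  let C := constraint_set U D in
  let weak := weakly_consistent U D X theta L Gam in
  let reaction_free := exists phi, is_section U D phi /\
    forall w, C w -> forall al : 'I_m,
      \sum_(a < p) \sum_(be < m) phi w 0 a *
        struct_fun X theta (rshift m a) (lshift p al) (lshift p be) w.1 *
        quasi_velocity theta (lshift p be) w = 0 in
  let bar_solves := exists phi, is_section U D phi /\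
    vakonomic_on U D X theta L phi (Gam_bar X theta L Gam phi) in
  (weak <-> reaction_free) /\ (reaction_free <-> bar_solves).
Proof.
move=> C weak reaction_free bar_solves.
(* For [Gam_bar] the condition on [nu] holds by reflexivity, so only reaction-freeness remains, for
   the same section [phi]. *)
have barP phi : vakonomic_on U D X theta L phi (Gam_bar X theta L Gam phi) <->
    forall w, C w -> forall al, reaction (X := X) (theta := theta) phi al w = 0.
  split=> [vak w Cw al|re0 _ [w Cw <-]].
    have Vw : vakonomic_eq X theta L (w, phi w) (Gam_bar X theta L Gam phi (w, phi w)).
      by apply: vak; exists w.
    exact: ((vakonomic_nonholonomicP hU hX htheta hL hGam phi w _ Cw).1 Vw).1.
  apply/(vakonomic_nonholonomicP hU hX htheta hL hGam phi w _ Cw).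
  by split=> // al; exact: re0.
split; split.
- move=> [phi [Gh [sphi [_ vak _] GhE]]]; exists phi; split=> // w Cw al.
  have Vw : vakonomic_eq X theta L (w, phi w) (Gam w, (Gh (w, phi w)).2).
    by rewrite -(GhE w Cw) -surjective_pairing; apply: vak; exists w.
  exact: ((vakonomic_nonholonomicP hU hX htheta hL hGam phi w _ Cw).1 Vw).1.
(* [Gam_bar] itself is the vakonomic field: its $TQ$-component is [Gam], whose tangency to $\mathcal
   C$ is part of the nonholonomic dynamics. *)
- move=> [phi [sphi re0]]; exists phi, (Gam_bar X theta L Gam phi); split=> //.
  split; first exact: smooth_on_Gam_bar.
    exact/barP.
  by move=> w Cw; have [] := hGam.2 w Cw.
- by move=> [phi [sphi re0]]; exists phi; split=> //; exact/barP.
- by move=> [phi [sphi /barP re0]]; exists phi.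
Qed.
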